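(* In genus $2$, up to the space of degree $24$, $$\mathfrak{D}^{(2)}\subsetneq\mathfrak{A}^{(2)}=\mathfrak{B}^{(2)},$$ that is, $\mathfrak{D}^{(2)}_{\le 24}\subsetneq\mathfrak{A}^{(2)}_{\le 24}=\mathfrak{B}^{(2)}_{\le 24}$.
   Context: A binary code of length $n$ is a linear subspace of $\mathbb{F}_2^n$ with inner product $u\cdot v=\sum_i u_iv_i$; it is self-dual if it equals its dual. A Type II code is a binary self-dual code all of whose codewords have weight (number of nonzero coordinates) divisible by $4$. Two self-dual codes of length $n$ are neighbors if their intersection has dimension $\frac n2-1$. For $n\equiv 0\pmod 8$, $d_n^+$ is the Type II code of length $n$ spanned by the vectors with support $\{1,2,2i-1,2i\}$ for $2\le i\le n/2$, together with the vector $(1,0,1,0,\dots,1,0)$. For a Type II code $C$ of length $n$, its weight enumerator in genus $g$ is the homogeneous polynomial of degree $n$ in the $2^g$ variables $x_a$ ($a\in\mathbb{F}_2^g$, written as column vectors) $$W_C^{(g)}(x_a : a\in\mathbb{F}_2^g)=\sum_{u_1,\dots,u_g\in C}\ \prod_{a\in\mathbb{F}_2^g}x_a^{n_a(u_1,\dots,u_g)},$$ where $n_a(u_1,\dots,u_g)$ is the number of $i\in\{1,\dots,n\}$ with $(u_{1i},\dots,u_{gi})^T=a$. Define the following $\mathbb{C}$-subalgebras of $\mathbb{C}[x_a : a\in\mathbb{F}_2^g]$: $\mathfrak{B}^{(g)}$ is generated by all $W_C^{(g)}$ with $C$ a Type II code (of any length); $\mathfrak{D}^{(g)}$ is generated by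 all $W_{d_n^+}^{(g)}$ with $n>0$, $n\equiv0\pmod 8$; $\mathfrak{A}^{(g)}$ is generated by all $W_C^{(g)}$ where, for some positive $n\equiv0\pmod 8$, $C$ is $d_n^+$ or a Type II neighbor of $d_n^+$. These are graded by degree; for such a ring $R$, $R_{\le 24}$ denotes the direct sum of its homogeneous components of degree at most $24$. *)

(* Defs.v *)
From HB Require Import structures.
From mathcomp Require Import all_boot all_order all_algebra.
From mathcomp Require Import classical_sets reals complex mpoly.

Set Implicit Arguments.
Unset Strict Implicit.
Unset Printing Implicit Defensive.

Import GRing.Theory.
Local Open Scope ring_scope.
Local Open Scope classical_set_scope.

Definition code (n : nat) := {vspace 'rV['F_2]_n}.

Definition dotp n (u v : 'rV['F_2]_n) : 'F_2 := \sum_(i < n) u 0 i * v 0 i.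

Definition hweight n (u : 'rV['F_2]_n) : nat := #|[set i | u 0 i != 0]%SET|.

Definition self_dual n (C : code n) : Prop :=
  forall v : 'rV['F_2]_n,
    v \in C <-> forall u : 'rV['F_2]_n, u \in C -> dotp u v = 0.

Definition type2 n (C : code n) : Prop :=
  self_dual C /\ forall u : 'rV['F_2]_n, u \in C -> (4 %| hweight u)%N.

(* The dimension condition dim (C :&: D) = n / 2 - 1 is written with a
   successor, which avoids the truncated subtraction of [nat] at [n = 0];
   [n./2] is exact since the length of a self-dual code is even. *)
Definition neighbors n (C D : code n) : Prop :=
  [/\ self_dual C, self_dual D & (\dim (C :&: D)).+1 = n./2].

(* Coordinates are numbered 1, ..., n: the index [j : 'I_n] stands for the
   position [j.+1]. *)
Definition dplus_tetrad n (i : nat) : 'rV['F_2]_n :=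
  \row_(j < n) (j.+1 \in [:: 1; 2; 2 * i - 1; 2 * i]%N)%:R.

Definition dplus_glue n : 'rV['F_2]_n := \row_(j < n) (odd j.+1)%:R.

Definition dplus n : code n :=
  <<dplus_glue n :: [seq dplus_tetrad n i | i <- index_iota 2 (n./2).+1]>>%VS.

(* The ring K[x_a : a in F_2^g]; the variable x_a is 'X_(enum_rank a). *)
Definition genus_poly (K : comNzRingType) (g : nat) :=
  {mpoly K[#|{: 'cV['F_2]_g}|]}.

Section WeightEnumerator.
Variables (K : comNzRingType) (g : nat).

(* n_a(u_1, ..., u_g) *)
Definition ncols n (u : {ffun 'I_g -> 'rV['F_2]_n}) (a : 'cV['F_2]_g) : nat :=
  #|[set i : 'I_n | \col_(k < g) u k 0 i == a]%SET|.

Definition weight_enum n (C : code n) : genus_poly K g :=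
  \sum_(u : {ffun 'I_g -> 'rV['F_2]_n} | [forall k, u k \in C])
    \prod_(a : 'cV['F_2]_g) 'X_(enum_rank a) ^+ ncols u a.

Definition subalg_gen (S : set (genus_poly K g)) : set (genus_poly K g) :=
  smallest (fun M : set (genus_poly K g) => GRing.subalg_closed (fun p => p \in M)) S.

Definition ringB : set (genus_poly K g) :=
  subalg_gen [set p | exists n (C : code n), type2 C /\ p = weight_enum C].

Definition ringD : set (genus_poly K g) :=
  subalg_gen [set p | exists n,
    [/\ (0 < n)%N, (8 %| n)%N & p = weight_enum (dplus n)]].

Definition ringA : set (genus_poly K g) :=
  subalg_gen [set p | exists n (C : code n),
    [/\ (0 < n)%N, (8 %| n)%N,
        C = dplus n \/ (type2 C /\ neighbors C (dplus n)) &
        p = weight_enum C]].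

Definition homog_comp (S : set (genus_poly K g)) (d : nat) :
    set (genus_poly K g) :=
  [set p | S p /\ p \is d.-homog].

(* The sum of the homogeneous components of degree at most m; it is
   automatically direct inside the polynomial ring. *)
Definition up_to_degree (m : nat) (S : set (genus_poly K g)) :
    set (genus_poly K g) :=
  [set p | exists q : 'I_m.+1 -> genus_poly K g,
    (forall d : 'I_m.+1, homog_comp S d (q d)) /\ p = \sum_(d < m.+1) q d].

End WeightEnumerator.

Arguments ringB K g _ : clear implicits.
Arguments ringD K g _ : clear implicits.
Arguments ringA K g _ : clear implicits.

(* Main.v *)
From Corelib Require Import BinNums.
From HB Require Import structures.
Require Import Defs.
From mathcomp Require Import all_boot all_order all_algebra.
From mathcomp Require Import classical_sets reals complex mpoly.
From mathcomp Require Import ssrZ zify ring finfield.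
Local Open Scope classical_set_scope.

(** Write W_C for the genus 2 weight enumerator of a Type II code C of length n.
It is the sum over pairs (u, v) of codewords of the monomials with exponents
(n_00, n_01, n_10, n_11), the type of the pair, so W_C amounts to the numbers
of pairs of each type.  Three facts restrict these numbers.

First, a Gauss sum shows that 8 divides n ([type2_dvd8]), and the divisibility
of the weights of u, v and u + v by 4 restricts the possible types.  Second,
replacing (u, v) by (v, u), by (u, u + v), or by (u + 1, v) with 1 the all-ones
word permutes the four entries of the type in every possible way, so that only
sorted types matter ([pair_count_sort4]): there are 3, 7 and 14 of them for
n = 8, 16 and 24.  Third, the MacWilliams identity in the second word of the
pair gives linear equations between the numbers ([macwilliams]).

Evaluating the MacWilliams identity at a few small integer points gives enough
equations to see that its solutions form a space of dimension 1 for n = 8 and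
n = 16, with coordinate the coefficient of x_00^n, and of dimension 3 for
n = 24, with coordinates the coefficients at the types (24,0,0,0), (20,4,0,0)
and (18,2,2,2) ([invariant8], [invariant16], [invariant24]).  For a code the
first coordinate is 1, the second is the number A of words of weight 4 and the
third is the number N of pairs of such words that meet in two positions.

Hence W_C = W_{d_n^+} for every Type II code of length 8 or 16.  In length 24,
the code d_24^+ and two of its neighbors, of types e_8 d_16 and d_12^2, have
(A, N) = (66, 1320), (42, 504) and (30, 240).  These three values are affinely
independent, so every W_C of length 24 is a combination of the corresponding
three weight enumerators ([pair_count24_interpolation]).  As all three algebras
are generated by homogeneous elements, the equality of the second and the third
in degree at most 24 follows ([subalg_gen_graded], [type2_ringA]).

For the strict inclusion, substitute 1 for x_00 and X for the other variables.
In W_C the coefficients of 1, X^4 and X^6 become 1, 3 A and N.  For n = 8 and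
n = 16 these are (1, 42, 168) and (1, 84, 336), that is, X^4 and X^6 have
coefficients (21/4) n and 21 n.  Such a relation, linear in the degree, is
stable under products, and it makes 3 c_6 - 34 c_4 + 2772 c_0 vanish in degree
24.  This form also vanishes on d_24^+, hence on all elements of degree 24 of
the algebra of the codes d_n^+, while its value on the neighbor of type d_12^2
is 432 ([low_coefs_mul], [low_coefs_d12]). *)

Set Implicit Arguments.
Unset Strict Implicit.
Unset Printing Implicit Defensive.

Import GRing.Theory Num.Theory.
Local Open Scope ring_scope.

(** * Binary words, characters and the length of a Type II code *)
Definition bit n (u : 'rV['F_2]_n) (i : 'I_n) : bool := u 0 i != 0.

Lemma F2_nat (a : 'F_2) : a = (a != 0)%:R.
Proof. by apply/val_inj; case: a => [[|[|m]]] //=. Qed.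

Lemma bitE n (u : 'rV['F_2]_n) i : u 0 i = (bit u i)%:R.
Proof. exact: F2_nat. Qed.

Lemma F2_natE (k : nat) : (k%:R == 0 :> 'F_2) = ~~ odd k.
Proof. by rewrite -(dvdn_pcharf (pchar_Fp (isT : prime 2))) dvdn2. Qed.

Lemma bit_row n (f : 'I_n -> bool) i : bit (\row_j (f j)%:R) i = f i.
Proof. by rewrite /bit mxE; case: (f i). Qed.

Lemma bit_inj n (u v : 'rV['F_2]_n) : bit u =1 bit v -> u = v.
Proof. by move=> e; apply/rowP => i; rewrite !bitE e. Qed.

Lemma bitD n (u v : 'rV['F_2]_n) i : bit (u + v) i = bit u i (+) bit v i.
Proof.
rewrite {1}/bit mxE (bitE u) (bitE v) -natrD F2_natE negbK.
by case: (bit u i); case: (bit v i).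
Qed.

Lemma bit0 n i : bit (0 : 'rV['F_2]_n) i = false.
Proof. by rewrite /bit mxE eqxx. Qed.

Lemma addrr_F2 n (u : 'rV['F_2]_n) : u + u = 0.
Proof. by apply: bit_inj => i; rewrite bitD bit0 addbb. Qed.

Lemma hweightE n (u : 'rV['F_2]_n) : hweight u = (\sum_i bit u i)%N.
Proof.
rewrite /hweight cardsE -sum1_card big_mkcond /=.
by apply: eq_bigr => i _; rewrite unfold_in /bit; case: (_ != _).
Qed.

Definition overlap n (u v : 'rV['F_2]_n) : nat := (\sum_i (bit u i && bit v i))%N.

Lemma dotp_overlap n (u v : 'rV['F_2]_n) : (dotp u v == 0) = ~~ odd (overlap u v).
Proof.
rewrite -F2_natE /dotp /overlap natr_sum; congr (_ == _); apply: eq_bigr => i _.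
by rewrite !bitE -natrM mulnb.
Qed.

Lemma overlapDl n (u w v : 'rV['F_2]_n) :
  odd (overlap (u + w) v) = odd (overlap u v) (+) odd (overlap w v).
Proof.
rewrite -oddD /overlap -big_split /= !(big_morph odd oddD (erefl _)).
apply: eq_bigr => i _; rewrite bitD oddD.
by case: (bit u i); case: (bit w i); case: (bit v i).
Qed.

Lemma hweightD n (u v : 'rV['F_2]_n) :
  (hweight (u + v) + 2 * overlap u v = hweight u + hweight v)%N.
Proof.
rewrite !hweightE /overlap big_distrr -!big_split; apply: eq_bigr => i _.
by rewrite bitD; case: (bit u i); case: (bit v i).
Qed.

Section Characters.
Variables (n : nat) (K : numDomainType).
Implicit Types (u v w : 'rV['F_2]_n) (C : code n).

Definition chi u v : K := (-1) ^+ overlap u v.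

Lemma chiDl u w v : chi (u + w) v = chi u v * chi w v.
Proof. by rewrite /chi -signr_odd overlapDl signr_addb !signr_odd. Qed.

Lemma chi_prod u v : chi u v = \prod_i (-1) ^+ (bit u i && bit v i).
Proof. by rewrite /chi /overlap (big_morph _ (exprD (-1)) (expr0 _)). Qed.

(** If some word w of C is not orthogonal to v, translation by w changes the sign
of the sum. *)
Lemma sum_chi_orth C v :
  \sum_(u in C) chi u v =
  if [forall (u | u \in C), dotp u v == 0] then #|C|%:R else 0.
Proof.
case: ifPn => [/forall_inP orth | /forall_inPn[w wC ov]].
  rewrite -sumr_const; apply: eq_bigr => u /orth; rewrite dotp_overlap => ev.
  by rewrite /chi -signr_odd (negbTE ev).
have cw : chi w v = -1 by rewrite dotp_overlap negbK in ov; rewrite /chi -signr_odd ov.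
set S := \sum_(u in C) _; apply/eqP.
suff SN : S = - S by rewrite -[S == 0](mulrn_eq0 S 2) mulr2n {1}SN addNr.
rewrite /S {1}(reindex_inj (addrI w)) -sumrN /=; apply: eq_big => [u|u _].
  exact: (rpredDl (S := C) u wC).
by rewrite chiDl cw mulN1r.
Qed.

Lemma sum_chi_selfdual C v : self_dual C ->
  \sum_(u in C) chi u v = if v \in C then #|C|%:R else 0.
Proof.
move=> sd; rewrite sum_chi_orth; congr (if _ then _ else _).
apply/forall_inP/idP => [o|vC u uC]; first by apply/sd => u /o /eqP.
by apply/eqP; move/sd: vC; apply.
Qed.

(** A product over the positions of sums over {0, 1} is a sum over all words: the
form in which both the Gauss sum and the MacWilliams transform factor. *)
Lemma prod_sum_bit (A : comNzRingType) (F : 'I_n -> bool -> A) :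
  \prod_i (F i false + F i true) = \sum_(z : 'rV['F_2]_n) \prod_i F i (bit z i).
Proof.
under eq_bigr => i _ do rewrite addrC -big_bool.
rewrite bigA_distr_bigA (reindex (fun z : 'rV['F_2]_n => [ffun i => bit z i])) /=.
  by apply: eq_bigr => z _; apply: eq_bigr => i _; rewrite ffunE.
exists (fun f : {ffun 'I_n -> bool} => \row_i (f i)%:R) => [z _|f _].
  by apply: bit_inj => i; rewrite bit_row ffunE.
by apply/ffunP => i; rewrite ffunE bit_row.
Qed.
End Characters.

Definition dual_set n (C : code n) : {set 'rV['F_2]_n} :=
  finset (fun v => [forall (u | u \in C), dotp u v == 0]).

(** Both orders of summation of the character chi(u, v) over u in C and all v. *)
Lemma card_dual n (C : code n) :
  (#|C| * #|dual_set C| = 2 ^ n)%N.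
Proof.
apply/eqP; rewrite -(eqr_nat rat); set D := dual_set C.
pose S : rat := \sum_(u in C) \sum_v chi rat u v.
have e1 : S = (#|C| * #|D|)%:R.
  rewrite /S exchange_big /= (bigID (mem D)) /= [X in _ + X]big1 => [|v]; last first.
    by rewrite inE sum_chi_orth => /negbTE->.
  rewrite addr0 natrM mulr_natr -sumr_const; apply: eq_bigr => v.
  by rewrite inE sum_chi_orth => ->.
have sym u v : chi rat u v = chi rat v u.
  by rewrite !chi_prod; apply: eq_bigr => i _; rewrite andbC.
have e2 : S = (2 ^ n)%:R.
  rewrite /S (bigD1 0) ?mem0v //= [X in _ + X]big1 => [|u /andP[_ u0]].
    rewrite addr0 (eq_bigr (fun=> 1)) => [|v _]; last first.
      by rewrite chi_prod big1 // => i _; rewrite bit0.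
    by rewrite sumr_const card_mx card_Fp // mul1n.
  under eq_bigr => v _ do rewrite sym.
  rewrite (eq_bigl (mem (fullv : code n))) => [|v]; last by rewrite /= memvf.
  rewrite sum_chi_orth ifN //; apply: contra u0 => /forall_inP o; apply/eqP/bit_inj => i.
  have := o (\row_j (j == i)%:R) (memvf _).
  rewrite dotp_overlap /overlap (bigD1 i) //= bit_row eqxx.
  rewrite big1 => [|j ji]; last by rewrite bit_row (negbTE ji).
  by rewrite addn0 bit0; case: (bit u i).
by rewrite -e1 e2.
Qed.

Lemma self_dual_card n (C : code n) : self_dual C -> (#|C| ^ 2 = 2 ^ n)%N.
Proof.
move=> sd; rewrite -(card_dual C) expnS expn1; congr (_ * _)%N.
apply: eq_card => v; rewrite inE; apply/idP/forall_inP => [/sd o u /o ->//|o].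
by apply/sd => u /o /eqP.
Qed.

Lemma self_dual_dim n (C : code n) : self_dual C -> n = (2 * \dim C)%N.
Proof.
move/self_dual_card; rewrite card_vspace card_Fp // -expnM mulnC.
by move/eqP; rewrite eqn_exp2l // => /eqP.
Qed.

Lemma self_dual_cardE n (C : code n) : self_dual C -> #|C| = (2 ^ n./2)%N.
Proof.
move=> /self_dual_dim e; rewrite card_vspace card_Fp //.
by have /(congr1 half) -> := e; rewrite mul2n doubleK.
Qed.

(** The sum of i^wt(z) over all words z is (1 + i)^n.  Averaging it over the
translations by C brings out the character sums of C, which kill the words z
outside C, so that the sum also equals |C| = 2^(n/2).  Comparing the two values
gives i^(n/2) = 1. *)
Lemma type2_dvd8 (K : numClosedFieldType) n (C : code n) : type2 C -> (8 %| n)%N.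
Proof.
move=> [sd de].
have iX2 : 'i ^+ 2 = -1 :> K by rewrite sqrCi.
pose G : K := \sum_(z : 'rV['F_2]_n) 'i ^+ hweight z.
have gprod : G = (1 + 'i) ^+ n.
  transitivity (\prod_(i < n) (1 + 'i) : K); last by rewrite prodr_const card_ord.
  have := prod_sum_bit (fun (_ : 'I_n) (b : bool) => 'i ^+ b : K).
  rewrite expr0 expr1 => ->; apply: eq_bigr => z _.
  by rewrite hweightE (big_morph _ (exprD 'i) (expr0 _)).
have doubly_even k : (4 %| k)%N -> 'i ^+ k = 1 :> K.
  by move=> /dvdnP[j ->]; rewrite mulnC exprM (exprM 'i 2 2) iX2 sqrrN !expr1n.
have shift (z u : 'rV['F_2]_n) : u \in C ->
    'i ^+ hweight (u + z) = 'i ^+ hweight z * chi K u z.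
  move=> uC; have i2 : 'i ^+ (2 * overlap u z) = chi K u z by rewrite exprM iX2.
  have chi2 : chi K u z * chi K u z = 1.
    by rewrite /chi -expr2 -exprM mulnC exprM sqrrN !expr1n.
  rewrite -[LHS]mulr1 -chi2 mulrA -{1}i2 -exprD hweightD exprD.
  by rewrite doubly_even ?mul1r ?de.
have CG : #|C|%:R * G = #|C|%:R * #|C|%:R.
  transitivity (\sum_(u in C) \sum_z 'i ^+ hweight z * chi K u z).
    rewrite mulr_natl -sumr_const; apply: eq_bigr => u uC.
    by rewrite /G (reindex_inj (addrI u)); apply: eq_bigr => z _; exact: shift.
  rewrite exchange_big /= (bigID (mem C)) /= [X in _ + X]big1 ?addr0 => [|z zC]; last first.
    by rewrite -mulr_sumr sum_chi_selfdual // (negbTE zC) mulr0.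
  rewrite mulr_natl -sumr_const; apply: eq_bigr => z zC.
  rewrite -mulr_sumr sum_chi_selfdual // zC.
  by rewrite doubly_even ?mul1r ?mulr1 ?de.
have C0 : #|C|%:R != 0 :> K 
  by rewrite pnatr_eq0 -lt0n; apply/card_gt0P; exists 0; exact: mem0v.
have {CG} := mulfI C0 CG; rewrite gprod self_dual_cardE //.
have [m nE] : exists m, n = (2 * m)%N by exists (\dim C); exact: self_dual_dim.
rewrite nE mul2n doubleK -mul2n exprM.
have -> : (1 + 'i) ^+ 2 = 2 * 'i :> K.
  by rewrite sqrrD iX2 expr1n mul1r addrAC subrr add0r mulr_natl.
rewrite exprMn natrX => /esym/eqP.
rewrite -{1}[2%:R ^+ m]mulr1 (inj_eq (mulfI _)) ?expf_neq0 ?pnatr_eq0 // eq_sym => im.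
suff d : (4 %| m)%N by exact: (dvdn_mul (dvdnn 2) d).
have i4 : 'i ^+ 4 = 1 :> K by rewrite (exprM 'i 2 2) iX2 sqrrN expr1n.
have {im} : 'i ^+ (m %% 4) == 1 :> K by rewrite -(expr_mod m i4) in im.
rewrite /dvdn; have : (m %% 4 < 4)%N by rewrite ltn_mod.
have n1 : (-1 : K) != 1 by rewrite -subr_eq0 -opprD oppr_eq0 -[1 + 1]/(2%:R) pnatr_eq0.
case: (m %% 4)%N => [|[|[|[|//]]]] // _ /eqP e.
- by move: iX2; rewrite -[X in X ^+ 2]expr1 e expr1n => /eqP; rewrite eq_sym (negbTE n1).
- by move: iX2; rewrite e => /eqP; rewrite eq_sym (negbTE n1).
- move: i4; rewrite exprS e mulr1 => e1.
  by move: iX2; rewrite e1 expr1n => /eqP; rewrite eq_sym (negbTE n1).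
Qed.

(** * Pairs of codewords and their types *)
(** The type (n_00, n_01, n_10, n_11) of a pair of words. *)
Notation quad := (nat * nat * nat * nat)%type.

Definition col_count n (u v : 'rV['F_2]_n) (a b : bool) : nat :=
  (\sum_i ((bit u i == a) && (bit v i == b)))%N.

Definition pair_type n (u v : 'rV['F_2]_n) : quad :=
  (col_count u v false false, col_count u v false true,
   col_count u v true false, col_count u v true true).

Definition type_monomial (A : comNzRingType) (x : bool -> bool -> A) (t : quad) : A :=
  let: (a, b, c, d) := t in
  x false false ^+ a * x false true ^+ b * x true false ^+ c * x true true ^+ d.

(** The weight enumerator of genus 2 with values x in an arbitrary commutative
ring; both integer points and the variables of a polynomial ring are used. *)
Definition pair_enum n (C : code n) (A : comNzRingType) (x : bool -> bool -> A) : A :=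
  \sum_(u in C) \sum_(v in C) \prod_i x (bit u i) (bit v i).

Definition pair_count n (C : code n) (t : quad) : nat :=
  (\sum_(u in C) \sum_(v in C) (pair_type u v == t))%N.

Lemma prod_pair_type n (u v : 'rV['F_2]_n) (A : comNzRingType) (x : bool -> bool -> A) :
  \prod_i x (bit u i) (bit v i) = type_monomial x (pair_type u v).
Proof.
have e a b : x a b ^+ col_count u v a b =
    \prod_i x a b ^+ ((bit u i == a) && (bit v i == b)).
  by rewrite /col_count (big_morph _ (exprD (x a b)) (expr0 _)).
rewrite /= !e -!big_split /=; apply: eq_bigr => i _.
by case: (bit u i); case: (bit v i); rewrite !(expr0, expr1, mul1r, mulr1).
Qed.

Section Types.
Variable n : nat.
Implicit Types (u v : 'rV['F_2]_n).

Lemma col_count_hweightl u v :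
  hweight u = (col_count u v true false + col_count u v true true)%N.
Proof.
rewrite hweightE /col_count -big_split; apply: eq_bigr => i _ /=.
by case: (bit u i); case: (bit v i).
Qed.

Lemma col_count_swap u v a b : col_count v u a b = col_count u v b a.
Proof. by apply: eq_bigr => i _; rewrite andbC. Qed.

Lemma col_count_hweightr u v :
  hweight v = (col_count u v false true + col_count u v true true)%N.
Proof. by rewrite (col_count_hweightl v u) !(col_count_swap u v). Qed.

Lemma col_count_addr u v a b : col_count u (u + v) a b = col_count u v a (a (+) b).
Proof.
apply: eq_bigr => i _; rewrite bitD.
by case: (bit u i); case: (bit v i); case: a; case: b.
Qed.

Lemma col_count_hweightD u v :
  hweight (u + v) = (col_count u v false true + col_count u v true false)%N.
Proof. by rewrite (col_count_hweightr u) !col_count_addr. Qed.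

Definition ones : 'rV['F_2]_n := \row_i true%:R.

Lemma bit_ones i : bit ones i = true.
Proof. exact: bit_row. Qed.

Lemma col_count_ones u v a b : col_count (ones + u) v a b = col_count u v (~~ a) b.
Proof. by apply: eq_bigr => i _; rewrite bitD bit_ones; case: (bit u i); case: a. Qed.

Lemma col_count_total u v :
  (col_count u v false false + col_count u v false true +
   col_count u v true false + col_count u v true true)%N = n.
Proof.
rewrite /col_count -!big_split -[RHS](card_ord n) -[RHS]sum1_card; apply: eq_bigr => i _ /=.
by case: (bit u i); case: (bit v i).
Qed.

End Types.

Section Beta.
Variables (n : nat) (C : code n).
Hypothesis t2 : type2 C.
Let sd : self_dual C. Proof. by case: t2. Qed.

Lemma ones_in : ones n \in C.
Proof.
apply/sd => u uC; apply/eqP; rewrite dotp_overlap.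
suff -> : overlap u (ones n) = hweight u.
  by have /dvdnP[k ->] := t2.2 u uC; rewrite oddM andbF.
by rewrite hweightE; apply: eq_bigr => i _; rewrite bit_ones andbT.
Qed.

Lemma pair_count_swap_bc a b c d : pair_count C (a, b, c, d) = pair_count C (a, c, b, d).
Proof.
rewrite /pair_count exchange_big; apply: eq_bigr => u _; apply: eq_bigr => v _.
by rewrite /pair_type !(col_count_swap u v) !xpair_eqE; do 4?case: (_ == _).
Qed.

Lemma pair_count_swap_cd a b c d : pair_count C (a, b, c, d) = pair_count C (a, b, d, c).
Proof.
rewrite /pair_count; apply: eq_bigr => u uC; rewrite (reindex_inj (addrI u)).
apply: eq_big => [v|v _]; first by rewrite (rpredDl (S := C)).
rewrite /pair_type !col_count_addr /= !xpair_eqE.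
by do 4?case: (_ == _).
Qed.

(** Adding the all-ones word to the first word of the pair exchanges n_00 with n_10
and n_01 with n_11. *)
Lemma pair_count_swap_ab a b c d : pair_count C (a, b, c, d) = pair_count C (b, a, c, d).
Proof.
suff e a' b' c' d' : pair_count C (a', b', c', d') = pair_count C (c', d', a', b').
  by rewrite e pair_count_swap_cd e.
rewrite /pair_count (reindex_inj (addrI (ones n))).
apply: eq_big => [u|u _]; first by rewrite (rpredDl (S := C)) ?ones_in.
apply: eq_bigr => v _; rewrite /pair_type !col_count_ones /= !xpair_eqE.
by do 4?case: (_ == _).
Qed.
End Beta.

Lemma hweight_eq0 n (u : 'rV['F_2]_n) : hweight u = 0%N -> u = 0.
Proof.
rewrite hweightE => /eqP; rewrite sum_nat_eq0 => /forallP h.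
by apply: bit_inj => i; have := h i; rewrite bit0; case: bit.
Qed.

Lemma pair_count_zero n (C : code n) : pair_count C (n, 0, 0, 0)%N = 1%N.
Proof.
have t0 : pair_type (0 : 'rV['F_2]_n) 0 == (n, 0, 0, 0)%N.
  have e a b : col_count (0 : 'rV['F_2]_n) 0 a b = ((~~ a && ~~ b) * n)%N.
    rewrite /col_count -[in RHS](card_ord n) mulnC -sum_nat_const; apply: eq_bigr => i _.
    by rewrite bit0; case: a; case: b.
  by apply/eqP; rewrite /pair_type !e /= mul1n.
have tn u v : pair_type u v == (n, 0, 0, 0)%N -> u = 0 :> 'rV['F_2]_n /\ v = 0.
  move=> /eqP[_ e1 e2 e3]; split; apply: hweight_eq0.
    by rewrite (col_count_hweightl u v) e2 e3.
  by rewrite (col_count_hweightr u v) e1 e3.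
rewrite /pair_count (bigD1 0) ?mem0v //= [X in (_ + X)%N]big1 => [|u /andP[_ u0]].
  rewrite (bigD1 0) ?mem0v //= t0 big1 // => v /andP[_ v0].
  by apply/eqP; rewrite eqb0; apply: contra v0 => /tn[_ ->].
by rewrite big1 // => v _; apply/eqP; rewrite eqb0; apply: contra u0 => /tn[->].
Qed.

(** * The MacWilliams identity and the spaces of invariants *)
Definition cmp_ab (t : quad) : quad :=
  let: (a, b, c, d) := t in if (a < b)%N then (b, a, c, d) else t.
Definition cmp_bc (t : quad) : quad :=
  let: (a, b, c, d) := t in if (b < c)%N then (a, c, b, d) else t.
Definition cmp_cd (t : quad) : quad :=
  let: (a, b, c, d) := t in if (c < d)%N then (a, b, d, c) else t.
(** Bubble sort, in decreasing order, by exchanges of adjacent entries: these are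
the exchanges under which the numbers of pairs are known to be invariant. *)
Definition sort4 (t : quad) : quad :=
  cmp_ab (cmp_bc (cmp_ab (cmp_cd (cmp_bc (cmp_ab t))))).

Lemma pair_count_sort4 n (C : code n) t : type2 C ->
  pair_count C (sort4 t) = pair_count C t.
Proof.
move=> t2; rewrite /sort4.
have ab s : pair_count C (cmp_ab s) = pair_count C s.
  by case: s => [[[a b] c] d] /=; case: ifP => // _; apply: pair_count_swap_ab.
have bc s : pair_count C (cmp_bc s) = pair_count C s.
  by case: s => [[[a b] c] d] /=; case: ifP => // _; apply: pair_count_swap_bc.
have cd s : pair_count C (cmp_cd s) = pair_count C s.
  by case: s => [[[a b] c] d] /=; case: ifP => // _; apply: pair_count_swap_cd.
by rewrite !(ab, bc, cd).
Qed.

Definition parts r n : seq nat := [seq r + 4 * i | i <- iota 0 (n %/ 4).+1]%N.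

(** The entries of a type have pairwise sums divisible by 4, hence are all even and
congruent modulo 4 to the same r, which is 0 or 2. *)
Definition pair_types_mod r n : seq quad :=
  [seq (p.1, p.2, c, n - (p.1 + p.2 + c))%N |
     p <- [seq p <- [seq (a, b) | a <- parts r n, b <- parts r n] | p.1 + p.2 <= n]%N,
     c <- [seq c <- parts r n | p.1 + p.2 + c <= n]%N].

Definition pair_types n : seq quad := pair_types_mod 0 n ++ pair_types_mod 2 n.

Lemma mem_parts r n a : (a <= n)%N -> (a %% 4)%N = r -> a \in parts r n.
Proof.
move=> le e; apply/mapP; exists (a %/ 4)%N; last by lia.
by rewrite mem_iota /=; lia.
Qed.

Lemma mem_pair_types n a b c d : (a + b + c + d = n)%N -> (8 %| n)%N ->
  (4 %| c + d)%N -> (4 %| b + d)%N -> (4 %| b + c)%N -> (a, b, c, d) \in pair_types n.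
Proof.
move=> e n8 cd bd bc; rewrite mem_cat.
have [r [ra rb rc r02]] : exists r,
    [/\ a %% 4 = r, b %% 4 = r, c %% 4 = r & (r == 0) || (r == 2)]%N.
  by exists (a %% 4)%N; split; lia.
suff h : (a, b, c, d) \in pair_types_mod r n.
  by move: r02 h => /orP[]/eqP-> ->; rewrite ?orbT.
have -> : d = (n - (a + b + c))%N by lia.
apply/allpairsPdep; exists (a, b), c; split => //;
  rewrite mem_filter; apply/andP; split; try (by rewrite /=; lia).
  by apply/allpairsPdep; exists a, b; rewrite !mem_parts //; lia.
by rewrite mem_parts //; lia.
Qed.

Lemma pair_type_in n (C : code n) u v : type2 C -> (8 %| n)%N ->
  u \in C -> v \in C -> pair_type u v \in pair_types n.
Proof.
move=> [sd de] n8 uC vC; apply: mem_pair_types => //; first exact: col_count_total.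
- by rewrite -col_count_hweightl de.
- by rewrite -col_count_hweightr de.
- by rewrite -col_count_hweightD de // memvD.
Qed.

Lemma pair_enum_types n (C : code n) (A : comNzRingType) (x : bool -> bool -> A) :
  type2 C -> (8 %| n)%N -> uniq (pair_types n) ->
  pair_enum C x = \sum_(t <- pair_types n) type_monomial x t *+ pair_count C t.
Proof.
move=> t2 n8 un; rewrite /pair_enum /pair_count.
under [RHS]eq_bigr => t _ do rewrite -sumrMnr.
rewrite [RHS]exchange_big; apply: eq_bigr => u uC.
under [RHS]eq_bigr => t _ do rewrite -sumrMnr.
rewrite [RHS]exchange_big; apply: eq_bigr => v vC.
rewrite prod_pair_type (bigD1_seq (pair_type u v) (pair_type_in t2 n8 uC vC)) //=.
rewrite eqxx mulr1n.
by rewrite big1 ?addr0 // => t tn; rewrite eq_sym (negbTE tn).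
Qed.

Definition sorted_types n : seq quad := undup [seq sort4 t | t <- pair_types n].

Definition orbit_sum n (A : comNzRingType) (x : bool -> bool -> A) (l : quad) : A :=
  \sum_(t <- pair_types n | sort4 t == l) type_monomial x t.

Lemma pair_enum_sorted n (C : code n) (A : comNzRingType) (x : bool -> bool -> A) :
  type2 C -> (8 %| n)%N -> uniq (pair_types n) ->
  pair_enum C x = \sum_(l <- sorted_types n) orbit_sum n x l *+ pair_count C l.
Proof.
move=> t2 n8 un; rewrite pair_enum_types //.
under [RHS]eq_bigr => l _ do rewrite /orbit_sum -sumrMnl.
rewrite (exchange_big_dep predT) //= big_seq [RHS]big_seq; apply: eq_bigr => t tT.
rewrite (eq_bigl (pred1 (sort4 t))) => [|l]; last by rewrite eq_sym.
rewrite -big_filter filter_pred1_uniq ?undup_uniq ?mem_undup ?map_f //.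
by rewrite big_seq1 pair_count_sort4.
Qed.

Definition hadamard (A : comNzRingType) (x : bool -> bool -> A) (a b : bool) : A :=
  x a false + (-1) ^+ b * x a true.

(** Poisson summation over the second word of the pair: the character sum over v in
C selects the words z of C. *)
Lemma macwilliams n (C : code n) (A : numDomainType) (x : bool -> bool -> A) :
  self_dual C -> pair_enum C (hadamard x) = 2 ^+ n./2 * pair_enum C x.
Proof.
move=> sd; rewrite /pair_enum mulr_sumr; apply: eq_bigr => u uC.
transitivity (\sum_(v in C) \sum_(z : 'rV['F_2]_n)
    chi A v z * \prod_i x (bit u i) (bit z i)).
  apply: eq_bigr => v vC.
  have := prod_sum_bit (fun i b => (-1) ^+ (bit v i && b) * x (bit u i) b).
  under eq_bigr => i _ do
    rewrite andbF andbT expr0 mul1r -/(hadamard x (bit u i) (bit v i)).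
  move=> ->; apply: eq_bigr => z _.
  by rewrite chi_prod -big_split.
rewrite exchange_big mulr_sumr [RHS]big_mkcond; apply: eq_bigr => z _.
rewrite -mulr_suml sum_chi_selfdual //; case: ifP => _; last by rewrite mul0r.
by rewrite self_dual_cardE // natrX.
Qed.

(** The linear condition that the MacWilliams identity puts on a function of sorted
types; it is required at integer points only, which makes each instance a
numerical linear equation. *)
Definition macwilliams_invariant n (f : quad -> Z) : Prop :=
  forall x : bool -> bool -> Z,
    \sum_(l <- sorted_types n) orbit_sum n (hadamard x) l * f l =
    2 ^+ n./2 * \sum_(l <- sorted_types n) orbit_sum n x l * f l.

Lemma pair_count_invariant n (C : code n) : type2 C -> (8 %| n)%N -> uniq (pair_types n) ->
  macwilliams_invariant n (fun l => (pair_count C l)%:R).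
Proof.
move=> t2 n8 un x; have := macwilliams x t2.1; rewrite !pair_enum_sorted //.
by rewrite (eq_bigr _ (fun l _ => esym (mulr_natr _ _))) => ->; congr (_ * _);
  apply: eq_bigr => l _; rewrite mulr_natr.
Qed.

Definition point (a b c d : Z) (s t : bool) : Z :=
  if s then if t then d else c else if t then b else a.

(** The same sum as [orbit_sum], in a form that evaluates. *)
Definition orbit_value n (x : bool -> bool -> Z) (l : quad) : Z :=
  foldr +%R 0 [seq type_monomial x t | t <- pair_types n & sort4 t == l].

Lemma orbit_valueE n x l : orbit_value n x l = orbit_sum n x l.
Proof. by rewrite /orbit_value foldrE big_map big_filter. Qed.

Definition macwilliams_row n (x : bool -> bool -> Z) : seq (Z * quad) :=
  [seq (orbit_value n (hadamard x) l - 2 ^+ n./2 * orbit_value n x l, l)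
     | l <- sorted_types n].

Lemma macwilliams_row_sum n f x : macwilliams_invariant n f ->
  \sum_(p <- macwilliams_row n x) p.1 * f p.2 = 0.
Proof.
move=> /(_ x) /eqP; rewrite -subr_eq0 mulr_sumr -sumrB => /eqP e.
rewrite -[RHS]e big_map; apply: eq_bigr => l _ /=.
by rewrite !orbit_valueE mulrBl mulrA.
Qed.

Lemma invariant0 n : macwilliams_invariant n (fun=> 0).
Proof. by move=> x; rewrite !big1 ?mulr0 // => l _; rewrite mulr0. Qed.

Lemma invariant_lin n a f g : macwilliams_invariant n f -> macwilliams_invariant n g ->
  macwilliams_invariant n (fun l => a * f l + g l).
Proof.
move=> fI gI x; have e y : \sum_(l <- sorted_types n) orbit_sum n y l * (a * f l + g l) =
    a * (\sum_(l <- sorted_types n) orbit_sum n y l * f l) +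
    \sum_(l <- sorted_types n) orbit_sum n y l * g l.
  by rewrite mulr_sumr -big_split; apply: eq_bigr => l _; rewrite /= mulrDr mulrCA.
by rewrite !e fI gI mulrDr mulrCA.
Qed.

(** Adds to the context the linear equation on the values of f given by the
MacWilliams identity at the point (a, b, c, d). *)
Ltac invariant_at inv a b c d :=
  let E := fresh "E" in
  have E := macwilliams_row_sum (point a b c d) inv;
  match type of E with context [macwilliams_row ?n ?x] =>
    let r := eval vm_compute in (macwilliams_row n x) in
    rewrite (_ : macwilliams_row n x = r) in E;
      [rewrite !big_cons big_nil /= in E | by vm_compute]
  end.

Lemma sorted_types8 : sorted_types 8 = [:: (4, 4, 0, 0); (8, 0, 0, 0); (2, 2, 2, 2)]%N.
Proof. by vm_compute. Qed.

(** The two equations determine f from f (8, 0, 0, 0). *)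
Lemma invariant8 f : macwilliams_invariant 8 f ->
  [/\ f (4, 4, 0, 0)%N = 14 * f (8, 0, 0, 0)%N, f (2, 2, 2, 2)%N = 168 * f (8, 0, 0, 0)%N &
   f (8, 0, 0, 0)%N = 0 -> {in sorted_types 8, forall l, f l = 0}].
Proof.
move=> inv.
invariant_at inv (0:Z) (0:Z) (0:Z) (1:Z).
invariant_at inv (0:Z) (1:Z) (0:Z) (1:Z).
split; [lia | lia | move=> f0].
suff h : all (fun l => f l == 0) (sorted_types 8) by move=> l /(allP h)/eqP.
by rewrite sorted_types8 /=; repeat (apply/andP; split); try apply/eqP; lia.
Qed.

Lemma sorted_types16 : sorted_types 16 =
  [:: (4, 4, 4, 4); (8, 4, 4, 0); (8, 8, 0, 0); (12, 4, 0, 0); (16, 0, 0, 0);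
      (6, 6, 2, 2); (10, 2, 2, 2)]%N.
Proof. by vm_compute. Qed.

Lemma invariant16 f : macwilliams_invariant 16 f ->
  [/\ f (12, 4, 0, 0)%N = 28 * f (16, 0, 0, 0)%N,
   f (10, 2, 2, 2)%N = 336 * f (16, 0, 0, 0)%N &
   f (16, 0, 0, 0)%N = 0 -> {in sorted_types 16, forall l, f l = 0}].
Proof.
move=> inv.
invariant_at inv (0:Z) (0:Z) (0:Z) (1:Z).
invariant_at inv (0:Z) (1:Z) (0:Z) (1:Z).
invariant_at inv (0:Z) (1:Z) (1:Z) (1:Z).
invariant_at inv (0:Z) (0:Z) (1:Z) (2:Z).
invariant_at inv (0:Z) (1:Z) (0:Z) (2:Z).
invariant_at inv (0:Z) (1:Z) (1:Z) (2:Z).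
split; [lia | lia | move=> f0].
suff h : all (fun l => f l == 0) (sorted_types 16) by move=> l /(allP h)/eqP.
by rewrite sorted_types16 /=; repeat (apply/andP; split); try apply/eqP; lia.
Qed.

Lemma sorted_types24 : sorted_types 24 =
  [:: (8, 8, 4, 4); (8, 8, 8, 0); (12, 4, 4, 4); (12, 8, 4, 0); (12, 12, 0, 0);
      (16, 4, 4, 0); (16, 8, 0, 0); (20, 4, 0, 0); (24, 0, 0, 0); (6, 6, 6, 6);
      (10, 6, 6, 2); (10, 10, 2, 2); (14, 6, 2, 2); (18, 2, 2, 2)]%N.
Proof. by vm_compute. Qed.

(** The eleven points were selected so that their equations have rank 11 on the 14
unknowns; the remaining freedom is that of the three given coordinates. *)
Lemma invariant24 f : macwilliams_invariant 24 f ->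
  f (24, 0, 0, 0)%N = 0 -> f (20, 4, 0, 0)%N = 0 -> f (18, 2, 2, 2)%N = 0 ->
  {in sorted_types 24, forall l, f l = 0}.
Proof.
move=> inv f0 f4 f6.
suff h : all (fun l => f l == 0) (sorted_types 24) by move=> l /(allP h)/eqP.
invariant_at inv (0:Z) (0:Z) (0:Z) (1:Z).
invariant_at inv (0:Z) (1:Z) (0:Z) (1:Z).
invariant_at inv (0:Z) (1:Z) (1:Z) (1:Z).
invariant_at inv (0:Z) (0:Z) (1:Z) (2:Z).
invariant_at inv (0:Z) (1:Z) (0:Z) (2:Z).
invariant_at inv (0:Z) (1:Z) (1:Z) (2:Z).
invariant_at inv (0:Z) (1:Z) (2:Z) (2:Z).
invariant_at inv (0:Z) (2:Z) (1:Z) (2:Z).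
invariant_at inv (1:Z) (1:Z) (1:Z) (2:Z).
invariant_at inv (1:Z) (2:Z) (1:Z) (2:Z).
invariant_at inv (1:Z) (2:Z) (2:Z) (2:Z).
rewrite sorted_types24 /= f0 f4 f6; rewrite f0 f4 f6 in E E0 E1 E2 E3 E4 E5 E6 E7 E8 E9.
(* At (0, 0, 0, 1) and (0, 0, 1, 2), both the point and its transform have at most
   two nonzero coordinates, so only types with at most two nonzero entries occur. *)
have [z1 z2] : f (12, 12, 0, 0)%N = 0 /\ f (16, 8, 0, 0)%N = 0 by clear -E E2; lia.
rewrite z1 z2; rewrite z1 z2 in E0 E1 E3 E4 E5 E6 E7 E8 E9.
clear inv f0 f4 f6 E E2 z1 z2.
move: (f (8, 8, 4, 4)%N) (f (8, 8, 8, 0)%N) (f (12, 4, 4, 4)%N) (f (12, 8, 4, 0)%N)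
  (f (16, 4, 4, 0)%N) (f (6, 6, 6, 6)%N) (f (10, 6, 6, 2)%N) (f (10, 10, 2, 2)%N)
  (f (14, 6, 2, 2)%N) E0 E1 E3 E4 E5 E6 E7 E8 E9.
clear f => a b c d e g h i j E0 E1 E3 E4 E5 E6 E7 E8 E9.
suff [[-> -> ->] [-> -> ->] [-> -> ->]] :
  [/\ [/\ a = 0, b = 0 & c = 0], [/\ d = 0, e = 0 & g = 0] &
   [/\ h = 0, i = 0 & j = 0]] by [].
by do 2!split; lia.
Qed.

Lemma uniq_pair_types n : n \in [:: 8; 16; 24]%N -> uniq (pair_types n).
Proof. by rewrite !inE => /or3P[]/eqP->; vm_compute. Qed.

(** * Codes given by lists of generators *)
Section Span.
Variable n : nat.
Implicit Types (u v : 'rV['F_2]_n) (X : seq 'rV['F_2]_n).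

Lemma span_cons_F2 g X v : v \in <<g :: X>>%VS -> v \in <<X>>%VS \/ v + g \in <<X>>%VS.
Proof.
rewrite span_cons => /memv_addP[u /vlineP[k ->] [w wX ->]].
rewrite (F2_nat k); case: (k != 0); [right | left].
  by rewrite scale1r addrAC addrr_F2 add0r.
by rewrite scale0r add0r.
Qed.

Lemma span_ind_F2 X (P : 'rV['F_2]_n -> Prop) :
  P 0 -> (forall g u, g \in X -> P u -> P (u + g)) -> forall v, v \in <<X>>%VS -> P v.
Proof.
move=> P0; elim: X => [_ v|g X IH PD v]; first by rewrite span_nil memv0 => /eqP ->.
have PX : forall u, u \in <<X>>%VS -> P u.
  by apply: IH => h u hX; apply: PD; rewrite inE hX orbT.
case/span_cons_F2 => [/PX //|/PX Pv].
by rewrite -(addr0 v) -(addrr_F2 g) addrA; apply: PD; rewrite ?mem_head.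
Qed.

End Span.

Lemma sum_nth_count (T : Type) (x0 : T) (p : pred T) n (s : seq T) : size s = n ->
  (\sum_(i < n) p (nth x0 s i) = count p s)%N.
Proof.
by move=> <-; rewrite -sum1_count (big_nth x0) big_mkord [RHS]big_mkcond.
Qed.

Section Words.
Variable n : nat.
Implicit Types (w : bitseq) (G : seq bitseq).

Definition vec w : 'rV['F_2]_n := \row_j (nth false w j)%:R.

Lemma bit_vec w i : bit (vec w) i = nth false w i.
Proof. exact: bit_row. Qed.

Definition addw (w w' : bitseq) : bitseq := [seq p.1 (+) p.2 | p <- zip w w'].

Lemma size_addw w w' : size w = n -> size w' = n -> size (addw w w') = n.
Proof. by move=> e e'; rewrite size_map size_zip e e' minnn. Qed.

Lemma vec_addw w w' : size w = n -> size w' = n -> vec (addw w w') = vec w + vec w'.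
Proof.
move=> e e'; apply: bit_inj => i; rewrite bitD !bit_vec.
by rewrite (nth_map (false, false)) ?nth_zip ?size_zip ?e ?e' ?minnn.
Qed.

(** All sums of subfamilies of G; a list without repetition when G is independent. *)
Fixpoint span_words G : seq bitseq :=
  if G is g :: G' then let W := span_words G' in W ++ map (addw g) W
  else [:: nseq n false].

Definition code_of G : code n := <<map vec G>>%VS.

Lemma size_span_words G : size (span_words G) = (2 ^ size G)%N.
Proof. by elim: G => //= g G IH; rewrite size_cat size_map IH expnS mul2n addnn. Qed.

Lemma all_size_span_words G : all (fun w => size w == n) G ->
  all (fun w => size w == n) (span_words G).
Proof.
elim: G => [_|g G IH /= /andP[/eqP sg /IH {}IH]]; first by rewrite /= size_nseq eqxx.
rewrite all_cat IH /=; apply/allP => _ /mapP[w /(allP IH) /eqP sw ->].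
by rewrite size_addw.
Qed.

Lemma mem_code_of G v : all (fun w => size w == n) G ->
  v \in code_of G -> v \in map vec (span_words G).
Proof.
rewrite /code_of; elim: G v => [|g G IH] v /=.
  rewrite span_nil memv0 => _ /eqP ->; rewrite inE; apply/eqP/bit_inj => i.
  by rewrite bit0 bit_vec nth_nseq if_same.
move=> /andP[/eqP sg sG]; rewrite map_cat mem_cat => /span_cons_F2[/(IH _ sG) ->//|].
move=> /(IH _ sG)/mapP[w wG e]; apply/orP; right.
apply/mapP; exists (addw g w); first exact: map_f.
have /allP/(_ w wG)/eqP sw := all_size_span_words sG.
by rewrite vec_addw // -e addrCA addrr_F2 addr0.
Qed.

(** Each word of the list has a position with entry 1 at which all later words are
zero; this makes independence a computation. *)
Fixpoint triangular G : bool :=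
  if G is g :: G' then
    has (fun j => nth false g j && all (fun h => ~~ nth false h j) G') (iota 0 n)
    && triangular G'
  else true.

Lemma triangular_free G : triangular G -> free (map vec G).
Proof.
elim: G => [|g G IH] /=; first by rewrite nil_free.
case/andP=> /hasP[j]; rewrite mem_iota add0n => /= jn /andP[gj hj] /IH fG.
rewrite free_cons fG andbT; apply/negP => gG.
have zero v : v \in code_of G -> bit v (Ordinal jn) = false.
  move: v; apply: span_ind_F2 => [|_ u /mapP[h hG ->] bu]; first by rewrite bit0.
  by rewrite bitD bu bit_vec /= (negbTE (allP hj h hG)).
by have := zero _ gG; rewrite bit_vec /= gj.
Qed.

Lemma dim_code_of G : triangular G -> \dim (code_of G) = size G.
Proof. by move=> /triangular_free; rewrite /free size_map => /eqP. Qed.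

Definition weight w : nat := count id w.

Lemma hweight_vec w : size w = n -> hweight (vec w) = weight w.
Proof.
move=> sw; rewrite hweightE /weight -(sum_nth_count false id sw).
by apply: eq_bigr => i _; rewrite bit_vec.
Qed.

Definition word_col_count w w' a b : nat := count (pred1 (a, b)) (zip w w').
Definition word_pair_type w w' : quad :=
  (word_col_count w w' false false, word_col_count w w' false true,
   word_col_count w w' true false, word_col_count w w' true true).

Lemma col_count_vec w w' a b : size w = n -> size w' = n ->
  col_count (vec w) (vec w') a b = word_col_count w w' a b.
Proof.
move=> sw sw'; have szip : size (zip w w') = n by rewrite size_zip sw sw' minnn.
rewrite /word_col_count -(sum_nth_count (false, false) _ szip).
by apply: eq_bigr => i _; rewrite nth_zip ?sw ?sw' // !bit_vec.
Qed.

Lemma overlap_col_count (u v : 'rV['F_2]_n) : overlap u v = col_count u v true true.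
Proof. by apply: eq_bigr => i _; case: (bit u i); case: (bit v i). Qed.

(** A computable certificate that G generates a Type II code. *)
Definition doubly_even_gens G : bool :=
  [&& all (fun w => size w == n) G, triangular G, (size G).*2 == n &
   all (fun w => 4 %| weight w)%N (span_words G)].

(** A doubly even linear code is self-orthogonal, because
2 |u & v| = wt(u) + wt(v) - wt(u + v), and one of dimension n/2 is then its own
dual by cardinality. *)
Lemma code_of_type2 G : doubly_even_gens G -> type2 (code_of G).
Proof.
case/and4P=> sG tG /eqP nG wG.
have de u : u \in code_of G -> (4 %| hweight u)%N.
  move=> /(mem_code_of sG)/mapP[w wW ->].
  by rewrite hweight_vec ?(allP wG) //; apply/eqP; apply: (allP (all_size_span_words sG)).
split=> //.
have sub : code_of G \subset dual_set (code_of G).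
  apply/fintype.subsetP => v vC; rewrite inE; apply/forall_inP => u uC.
  rewrite dotp_overlap.
  have := hweightD u v; have := de _ uC; have := de _ vC; have := de _ (memvD uC vC).
  move: (hweight u) (hweight v) (hweight (u + v)) (overlap u v) => a b c d; lia.
have eC : #|code_of G| = (2 ^ size G)%N by rewrite card_vspace card_Fp // dim_code_of.
have eD : #|code_of G| = #|dual_set (code_of G)|.
  apply/eqP; rewrite -(eqn_pmul2l (m := #|code_of G|)) ?card_dual ?eC ?expn_gt0 //.
  by rewrite -expnD addnn nG.
move=> v; rewrite (subset_cardP eD sub) inE; split=> [/forall_inP o u /o /eqP //|o].
by apply/forall_inP => u /o ->.
Qed.

Lemma self_dual_mem G w : self_dual (code_of G) ->
  all (fun w => size w == n) G -> size w = n ->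
  (vec w \in code_of G) = all (fun g => ~~ odd (word_col_count g w true true)) G.
Proof.
move=> sd sG sw; apply/idP/allP => [/sd o g gG|o].
  have /eqP := o (vec g) (memv_span (map_f vec gG)).
  by rewrite dotp_overlap overlap_col_count col_count_vec //; apply/eqP; exact: (allP sG).
apply/sd => u uC; apply/eqP; rewrite dotp_overlap.
move: u uC; apply: span_ind_F2 => [|_ u /mapP[g gG ->] eu].
  by rewrite /overlap big1 // => i _; rewrite bit0.
rewrite overlapDl (negbTE eu) overlap_col_count col_count_vec ?o //.
by apply/eqP; exact: (allP sG).
Qed.

Lemma sum_code_of G (A : nmodType) (F : 'rV['F_2]_n -> A) : doubly_even_gens G ->
  \sum_(u in code_of G) F u = \sum_(w <- span_words G) F (vec w).
Proof.
case/and4P=> sG tG /eqP nG wG.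
have sub : {subset enum (code_of G) <= map vec (span_words G)}.
  by move=> u; rewrite mem_enum; exact: mem_code_of.
have sz : size (map vec (span_words G)) = size (enum (code_of G)).
  by rewrite size_map size_span_words -cardE card_vspace card_Fp // dim_code_of.
rewrite -(big_map vec predT F) -big_enum /=.
have [_ e] := uniq_min_size (enum_uniq (code_of G)) sub (eq_leq sz).
apply: perm_big; apply: uniq_perm => //; first exact: enum_uniq.
by rewrite (leq_size_uniq (enum_uniq _) sub) ?sz.
Qed.

Definition words_of_weight G k : seq bitseq := [seq w <- span_words G | weight w == k].

Definition count_pairs (t : quad) (W W' : seq bitseq) : nat :=
  sumn [seq sumn [seq nat_of_bool (word_pair_type w w' == t) | w' <- W'] | w <- W].

(** The type of a pair fixes the weights of its two words, so that only the words of
these weights have to be paired. *)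
Lemma pair_count_code_of G a b c d : doubly_even_gens G ->
  pair_count (code_of G) (a, b, c, d) =
  count_pairs (a, b, c, d) (words_of_weight G (c + d)) (words_of_weight G (b + d)).
Proof.
rewrite /count_pairs /words_of_weight.
move=> gG; have [sG _ _ _] := and4P gG.
have /allP sW := all_size_span_words sG.
rewrite /pair_count sum_code_of // sumnE big_map big_filter [RHS]big_mkcond /=.
rewrite big_seq [RHS]big_seq; apply: eq_bigr => w /sW /eqP sw.
rewrite sum_code_of //.
transitivity (\sum_(w' <- span_words G) (word_pair_type w w' == (a, b, c, d)))%N.
  rewrite big_seq [RHS]big_seq; apply: eq_bigr => w' /sW /eqP sw'.
  by rewrite /pair_type !col_count_vec.
have wt w' : w' \in span_words G -> word_pair_type w w' == (a, b, c, d) ->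
    (weight w == c + d)%N /\ (weight w' == b + d)%N.
  move=> /sW /eqP sw' /eqP[_ eb ec ed]; split.
    by rewrite -hweight_vec // (col_count_hweightl _ (vec w')) !col_count_vec // ec ed.
  by rewrite -hweight_vec // (col_count_hweightr (vec w)) !col_count_vec // eb ed.
case: ifP => [_|/negbT nw].
  rewrite sumnE big_map big_filter [RHS]big_mkcond big_seq [RHS]big_seq.
  apply: eq_bigr => w' w'W.
  by case: ifP => // /negbT nw'; case: eqP => // /eqP /(wt _ w'W)[_]; rewrite (negbTE nw').
rewrite big_seq big1 // => w' w'W.
by case: eqP => // /eqP /(wt _ w'W)[]; rewrite (negbTE nw).
Qed.

End Words.

(** * The code of type d_n^+ and two of its neighbors *)
Definition tetrad n i : bitseq := mkseq (fun j => j.+1 \in [:: 1; 2; 2 * i - 1; 2 * i]%N) n.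
Definition glue n : bitseq := mkseq (fun j => odd j.+1) n.
(** The glue word comes last, because every one of its positions is covered by the
tetrads: this order is triangular. *)
Definition dplus_gens n : seq bitseq :=
  rcons [seq tetrad n i | i <- index_iota 2 n./2.+1] (glue n).

Lemma dplus_code_of n : dplus n = code_of n (dplus_gens n).
Proof.
rewrite /dplus; have -> : dplus_glue n = vec n (glue n).
  by apply/rowP => j; rewrite !mxE nth_mkseq.
apply: eq_span => u; rewrite /dplus_gens map_rcons mem_rcons -map_comp !in_cons.
congr (_ || (u \in _)).
by apply: eq_map => i; apply/rowP => j; rewrite !mxE nth_mkseq.
Qed.

Definition word_of n (s : seq nat) : bitseq := mkseq (fun j => j.+1 \in s) n.

(** All generators but the last are orthogonal to the self-dual code generated by H,
hence lie in it, and the last one is not. *)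
Lemma neighbors_code_of n G H w : doubly_even_gens n (rcons G w) -> doubly_even_gens n H ->
  all (fun g => all (fun h => ~~ odd (word_col_count h g true true)) H) G ->
  ~~ all (fun h => ~~ odd (word_col_count h w true true)) H ->
  neighbors (code_of n (rcons G w)) (code_of n H).
Proof.
move=> gC gD GD wD; have [sC tC nC _] := and4P gC; have [sD _ _ _] := and4P gD.
have [[sdC _] [sdD _]] := (code_of_type2 gC, code_of_type2 gD).
move: (sC) (nC); rewrite all_rcons size_rcons => /andP[/eqP sw sG] /eqP nE.
have {nE} nE : n./2 = (size G).+1 by rewrite -[in LHS]nE doubleK.
split=> //; rewrite nE; congr _.+1; apply/eqP; rewrite eqn_leq; apply/andP; split.
  rewrite -ltnS -(size_rcons G w) -(dim_code_of tC) ltn_neqAle dimvS ?capvSl // andbT.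
  apply: contraNN wD => /eqP e; rewrite -(self_dual_mem sdD) //.
  have : vec n w \in code_of n (rcons G w).
    by rewrite memv_span // map_f // mem_rcons mem_head.
  have /eqP <- : (code_of n (rcons G w) :&: code_of n H == code_of n (rcons G w))%VS.
    by rewrite eqEdim capvSl e leqnn.
  by rewrite memv_cap => /andP[].
have fG : free (map (vec n) G).
  by have := triangular_free tC; rewrite map_rcons -cats1 => /catl_free.
have <- : \dim (code_of n G) = size G by move: fG; rewrite /free size_map => /eqP.
apply: dimvS; apply/span_subvP => _ /mapP[g gG ->]; rewrite memv_cap.
rewrite memv_span ?map_f ?mem_rcons ?inE ?gG ?orbT //.
rewrite (self_dual_mem sdD sD) ?(allP GD) //; apply/eqP; exact: (allP sG).
Qed.

Section Length24.
Local Open Scope nat_scope.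

Definition d24_gens : seq bitseq := dplus_gens 24.

(** Generators of the subcode of d_24^+ orthogonal to the word with support
{1, 3, 5, 7}; this word completes it to the code of type e_8 d_16. *)
Definition e8d16_sub : seq bitseq :=
  let t := tetrad 24 in
  [:: t 2; t 3; t 4] ++ [seq addw (t 5) (t i) | i <- iota 6 7] ++ [:: glue 24].
Definition e8d16_gens : seq bitseq := rcons e8d16_sub (word_of 24 [:: 1; 3; 5; 7]).

(** Generators of the subcode of d_24^+ orthogonal to the word v with support
{1, 3, 5, 7, 9, 12, 13, 14}.  A union of pairs {2i-1, 2i} is orthogonal to v when
it has an even number of pairs among the first six, so that the tetrads of the
neighbor lie in two families of type d_12.  The order of the words makes the list
of generators triangular. *)
Definition d12_sub : seq bitseq :=
  let t := tetrad 24 in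
  [seq t i | i <- iota 2 4] ++ [seq addw (t 7) (t i) | i <- iota 8 5] ++ [:: t 6; glue 24].
Definition d12_gens : seq bitseq :=
  rcons d12_sub (word_of 24 [:: 1; 3; 5; 7; 9; 12; 13; 14]).

Lemma d8_even : doubly_even_gens 8 (dplus_gens 8). Proof. by vm_compute. Qed.
Lemma d16_even : doubly_even_gens 16 (dplus_gens 16). Proof. by vm_compute. Qed.
Lemma d24_even : doubly_even_gens 24 d24_gens. Proof. by vm_compute. Qed.
Lemma e8d16_even : doubly_even_gens 24 e8d16_gens. Proof. by vm_compute. Qed.
Lemma d12_even : doubly_even_gens 24 d12_gens. Proof. by vm_compute. Qed.

Lemma e8d16_neighbor : neighbors (code_of 24 e8d16_gens) (dplus 24).
Proof.
by rewrite dplus_code_of; apply: (neighbors_code_of e8d16_even d24_even); vm_compute.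
Qed.

Lemma d12_neighbor : neighbors (code_of 24 d12_gens) (dplus 24).
Proof.
by rewrite dplus_code_of; apply: (neighbors_code_of d12_even d24_even); vm_compute.
Qed.

Lemma d24_count4 : pair_count (code_of 24 d24_gens) (20, 4, 0, 0) = 66.
Proof. by rewrite pair_count_code_of ?d24_even //; vm_compute. Qed.
Lemma d24_count6 : pair_count (code_of 24 d24_gens) (18, 2, 2, 2) = 1320.
Proof. by rewrite pair_count_code_of ?d24_even //; vm_compute. Qed.
Lemma e8d16_count4 : pair_count (code_of 24 e8d16_gens) (20, 4, 0, 0) = 42.
Proof. by rewrite pair_count_code_of ?e8d16_even //; vm_compute. Qed.
Lemma e8d16_count6 : pair_count (code_of 24 e8d16_gens) (18, 2, 2, 2) = 504.
Proof. by rewrite pair_count_code_of ?e8d16_even //; vm_compute. Qed.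
Lemma d12_count4 : pair_count (code_of 24 d12_gens) (20, 4, 0, 0) = 30.
Proof. by rewrite pair_count_code_of ?d12_even //; vm_compute. Qed.
Lemma d12_count6 : pair_count (code_of 24 d12_gens) (18, 2, 2, 2) = 240.
Proof. by rewrite pair_count_code_of ?d12_even //; vm_compute. Qed.
End Length24.

(** * Subalgebras and homogeneous components *)
Section Graded.
Variables (K : comNzRingType) (g : nat).
Notation poly := (genus_poly K g).
Implicit Types (p q : poly) (S M : set poly).

Lemma subalg_closedP M : GRing.subalg_closed (fun p => p \in M) <->
  [/\ M 1, forall a p q, M p -> M q -> M (a *: p + q) &
      forall p q, M p -> M q -> M (p * q)].
Proof.
split=> -[M1 Ml Mm]; split.
- by move: M1; rewrite unfold_in inE.
- move=> a p q Mp Mq; have := Ml a p q; rewrite !unfold_in !inE; exact.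
- move=> p q Mp Mq; have := Mm p q; rewrite !unfold_in !inE; exact.
- by rewrite unfold_in inE.
- by move=> a p q; rewrite !unfold_in !inE => Mp Mq; apply: Ml.
- by move=> p q; rewrite !unfold_in !inE => Mp Mq; apply: Mm.
Qed.

Lemma subalg_gen_incl S p : S p -> subalg_gen S p.
Proof. exact: sub_gen_smallest. Qed.

Lemma subalg_gen_min S M : GRing.subalg_closed (fun p => p \in M) ->
  S `<=` M -> subalg_gen S `<=` M.
Proof. exact: smallest_sub. Qed.

Lemma subalg_gen_closed S :
  [/\ subalg_gen S 1,
      forall a p q, subalg_gen S p -> subalg_gen S q -> subalg_gen S (a *: p + q) &
      forall p q, subalg_gen S p -> subalg_gen S q -> subalg_gen S (p * q)].
Proof.
split=> [M [/subalg_closedP[M1 _ _] _] //|a p q Sp Sq M MM|p q Sp Sq M MM];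
  have [/subalg_closedP[_ Ml Mm] _] := MM.
  by apply: Ml; [exact: Sp | exact: Sq].
by apply: Mm; [exact: Sp | exact: Sq].
Qed.

(** A family of subspaces V_d that is multiplicative in degrees at most m, and
contains the homogeneous generators of these degrees, contains the homogeneous
components of every element of the generated algebra: multiply the
decompositions of two elements component by component. *)
Lemma subalg_gen_graded S (m : nat) (V : nat -> set poly) :
  (forall d, V d 0) ->
  (forall d a p q, V d p -> V d q -> V d (a *: p + q)) ->
  V 0%N 1 ->
  (forall i j p q, (i + j <= m)%N -> V i p -> V j q -> V (i + j)%N (p * q)) ->
  (forall p, S p -> exists2 d, p \is d.-homog & (d <= m)%N -> V d p) ->
  forall p, subalg_gen S p -> forall d, (d <= m)%N -> V d (pihomog mdeg d p).
Proof.
move=> V0 Vl V1 Vm VS.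
have VD d p q : V d p -> V d q -> V d (p + q) by rewrite -{2}[p]scale1r; exact: Vl.
pose M : set poly := [set p | forall d, (d <= m)%N -> V d (pihomog mdeg d p)].
apply: (@subalg_gen_min _ M) => [|p /VS[e hp Vp] d dm]; last first.
  have [ed|ed] := eqVneq e d; first by rewrite pihomog_dE -ed //; apply: Vp; rewrite ed.
  by rewrite (pihomog_ne0 ed hp).
apply/subalg_closedP; split.
- move=> d dm; case: d dm => [|d] dm; first by rewrite pihomog_dE ?dhomog1.
  by rewrite (@pihomog_ne0 _ _ _ 0%N) ?dhomog1.
- by move=> a p q Vp Vq d dm; rewrite linearP; apply: Vl; [exact: Vp | exact: Vq].
move=> p q Vp Vq d dm.
rewrite (pihomog_partitionE (leqnn (mmeasure mdeg p))).
rewrite (pihomog_partitionE (leqnn (mmeasure mdeg q))).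
rewrite mulr_suml linear_sum /=; apply: (big_ind (V d)) => // [|i _]; first exact: VD.
rewrite mulr_sumr linear_sum /=; apply: (big_ind (V d)) => // [|j _]; first exact: VD.
have hij : pihomog mdeg i p * pihomog mdeg j q \is (i + j).-homog.
  by rewrite dhomogM ?pihomogP.
have [ed|ed] := eqVneq (i + j)%N d; last by rewrite (pihomog_ne0 ed hij).
rewrite pihomog_dE -ed //; apply: Vm; rewrite ?ed //; [apply: Vp | apply: Vq]; lia.
Qed.

Lemma up_to_degreeP (m : nat) S S' :
  (forall d p, (d <= m)%N -> S p -> p \is d.-homog -> S' p) ->
  up_to_degree m S `<=` up_to_degree m S'.
Proof.
move=> SS' _ [q [qS ->]]; exists q; split => // d; have [Sq hq] := qS d.
by split => //; apply: SS' Sq hq; rewrite -ltnS.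
Qed.

Lemma subalg_gen0 S : subalg_gen S 0.
Proof.
have [S1 Sl _] := subalg_gen_closed S.
by rewrite -[0](addNr 1) -scaleN1r; exact: Sl.
Qed.

Lemma up_to_degree_homog (m d : nat) S p : (d <= m)%N -> p \is d.-homog ->
  up_to_degree m (subalg_gen S) p <-> subalg_gen S p.
Proof.
move=> dm hp; split=> [[q [qS ep]]|Sp].
  rewrite -(pihomog_dE hp) ep linear_sum /=.
  rewrite (bigD1 (Ordinal (dm : (d < m.+1)%N))) //= big1 ?addr0 => [|e ed].
    by rewrite pihomog_dE; have [] := qS (Ordinal (dm : (d < m.+1)%N)).
  by rewrite (@pihomog_ne0 _ _ _ e) //; have [] := qS e.
exists (fun e : 'I_m.+1 => if e == d :> nat then p else 0); split=> [e|].
  by case: eqP => [->|_]; split; rewrite ?rpred0 //; exact: subalg_gen0.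
rewrite (bigD1 (Ordinal (dm : (d < m.+1)%N))) //= eqxx big1 ?addr0 // => e ed.
by case: eqP => // ee; case/negP: ed; apply/eqP/val_inj.
Qed.
End Graded.

(** * The genus 2 weight enumerator as a sum over pairs of codewords *)
Section WeightEnum.
Variable K : comNzRingType.
Notation poly := (genus_poly K 2).

Definition pairvec (a b : bool) : 'cV['F_2]_2 := \col_k (if k == 0 then a else b)%:R.

Definition gvar (a b : bool) : poly := 'X_(enum_rank (pairvec a b)).

Lemma weight_enum_pair_enum n (C : code n) : weight_enum K 2 C = pair_enum C gvar.
Proof.
rewrite /weight_enum /pair_enum.
have prodE (u : {ffun 'I_2 -> 'rV['F_2]_n}) :
    \prod_(a : 'cV['F_2]_2) 'X_(enum_rank a) ^+ ncols u a =
    \prod_i gvar (bit (u 0) i) (bit (u 1) i).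
  rewrite [RHS](partition_big (fun i => \col_(k < 2) u k 0 i) predT) //.
  apply: eq_bigr => a _; rewrite /ncols -prodr_const big_mkcond [RHS]big_mkcond.
  apply: eq_bigr => i _; rewrite inE; case: eqP => // <-.
  rewrite /gvar; congr ('X_(enum_rank _)); apply/matrixP => k j; rewrite !mxE.
  by case: k => [[|[|k]]] //= kl; rewrite -bitE; congr (u _ 0 i); apply/val_inj.
under eq_bigr => u _ do rewrite prodE.
rewrite pair_big /=.
rewrite (reindex (fun p : 'rV['F_2]_n * 'rV['F_2]_n =>
  [ffun k : 'I_2 => if k == 0 then p.1 else p.2])) /=.
  apply: eq_big => [p|p _]; last by rewrite !ffunE.
  apply/forallP/andP => [h|[h1 h2] k]; last by rewrite ffunE; case: ifP.
  by have := h 0; have := h 1; rewrite !ffunE.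
exists (fun u : {ffun 'I_2 -> 'rV['F_2]_n} => (u 0, u 1)) => [[u v] _|u _].
  by rewrite !ffunE.
apply/ffunP => k; rewrite ffunE; case: k => [[|[|k]]] //= kl; congr (u _); exact/val_inj.
Qed.

Lemma weight_enum_homog n (C : code n) : weight_enum K 2 C \is n.-homog.
Proof.
rewrite weight_enum_pair_enum; apply: rpred_sum => u _; apply: rpred_sum => v _.
suff : \prod_i gvar (bit u i) (bit v i) \is (\sum_(i < n) 1)%N.-homog.
  by rewrite sum1_card card_ord.
elim/big_rec2: _ => [|i d p _ hp]; first exact: dhomog1.
by apply: dhomogM => //; rewrite dhomogX; apply/eqP; exact: mdeg1.
Qed.
End WeightEnum.

(** * Relations between weight enumerators *)
Section PairEnumRelations.
Variable A : comNzRingType.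
Implicit Types (x : bool -> bool -> A).

Definition ofZ (z : Z) : A := (int_of_Z z)%:~R.

Lemma ofZM a b : ofZ (a * b) = ofZ a * ofZ b.
Proof. by rewrite /ofZ rmorphM /= intrM. Qed.
Lemma ofZD a b : ofZ (a + b) = ofZ a + ofZ b.
Proof. by rewrite /ofZ rmorphD /= intrD. Qed.
Lemma ofZ_nat k : ofZ k%:R = k%:R.
Proof. by rewrite /ofZ !rmorph_nat. Qed.

Lemma pair_enum_relation n (C C1 C2 C3 : code n) (d a1 a2 a3 : Z) x :
  type2 C -> type2 C1 -> type2 C2 -> type2 C3 -> (8 %| n)%N -> uniq (pair_types n) ->
  {in sorted_types n, forall l, d * (pair_count C l)%:R =
     a1 * (pair_count C1 l)%:R + a2 * (pair_count C2 l)%:R + a3 * (pair_count C3 l)%:R} ->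
  ofZ d * pair_enum C x =
    ofZ a1 * pair_enum C1 x + ofZ a2 * pair_enum C2 x + ofZ a3 * pair_enum C3 x.
Proof.
move=> t t1 t2 t3 n8 un e; rewrite !pair_enum_sorted // !mulr_sumr -!big_split.
rewrite big_seq [RHS]big_seq; apply: eq_bigr => l /e /(congr1 ofZ) el /=.
rewrite !ofZD !ofZM !ofZ_nat in el.
rewrite -!(mulr_natl (orbit_sum n x l)) !mulrA el.
by rewrite !mulrDl.
Qed.

(** The difference of the numbers of pairs for the two codes is invariant and
vanishes at (n, 0, 0, 0), as each code has exactly one pair of zero words. *)
Lemma pair_enum_unique n (C C' : code n) x :
  (forall f, macwilliams_invariant n f -> f (n, 0, 0, 0)%N = 0 ->
    {in sorted_types n, forall l, f l = 0}) ->
  (8 %| n)%N -> uniq (pair_types n) -> type2 C -> type2 C' ->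
  pair_enum C x = pair_enum C' x.
Proof.
move=> det n8 un t t'; rewrite !pair_enum_sorted //.
rewrite big_seq [RHS]big_seq; apply: eq_bigr => l lo; congr (_ *+ _).
have := det _ (invariant_lin (-1) (pair_count_invariant t n8 un)
  (pair_count_invariant t' n8 un)).
rewrite !pair_count_zero mulN1r addNr => /(_ erefl l lo) /=; lia.
Qed.
End PairEnumRelations.

(** Lagrange interpolation in A at the nodes 66, 42 and 30: the coefficients are
(A - 42) (A - 30), -3 (A - 66) (A - 30) and 2 (A - 66) (A - 42), over the common
denominator 864, with A^2 written as 3 N + 6 A, a relation that holds for the
three codes on the right.  By [invariant24], comparing the values 1, A and N
suffices. *)
Lemma pair_count24_interpolation (C : code 24) (A N : Z) : type2 C ->
  A = (pair_count C (20, 4, 0, 0)%N)%:R -> N = (pair_count C (18, 2, 2, 2)%N)%:R ->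
  {in sorted_types 24, forall l, 864 * (pair_count C l)%:R =
     (3 * N - 66 * A + 1260) * (pair_count (code_of 24 d24_gens) l)%:R +
     - 3 * (3 * N - 90 * A + 1980) * (pair_count (code_of 24 e8d16_gens) l)%:R +
     2 * (3 * N - 102 * A + 2772) * (pair_count (code_of 24 d12_gens) l)%:R :> Z}.
Proof.
move=> t eA eN l lo.
have inv G : doubly_even_gens 24 G ->
    macwilliams_invariant 24 (fun l => (pair_count (code_of 24 G) l)%:R).
  move=> hG; have un24 := uniq_pair_types (n := 24) isT.
  exact: (pair_count_invariant (code_of_type2 hG) (isT : (8 %| 24)%N) un24).
have invC := pair_count_invariant t isT (uniq_pair_types (n := 24) isT).
have /invariant24/= I := invariant_lin (-864) invC
  (invariant_lin (3 * N - 66 * A + 1260) (inv _ d24_even)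
  (invariant_lin (- 3 * (3 * N - 90 * A + 1980)) (inv _ e8d16_even)
  (invariant_lin (2 * (3 * N - 102 * A + 2772)) (inv _ d12_even) (@invariant0 24)))).
rewrite !pair_count_zero d24_count4 d24_count6 e8d16_count4 e8d16_count6 in I.
rewrite d12_count4 d12_count6 -eA -eN in I.
have /= := I _ _ _ l lo; lia.
Qed.

(** * Support weights of pairs of codewords *)
Section Truncation.
Variable K : comNzRingType.
Notation poly := (genus_poly K 2).

(** The substitution of 1 for x_00 and of X for the other three variables: a pair
(u, v) contributes X to the size of the union of the supports of u and v. *)
Definition support_poly : poly -> {poly K} :=
  mmap polyC (fun i => if i == enum_rank (0 : 'cV['F_2]_2) then 1 else 'X).
HB.instance Definition _ := GRing.RMorphism.on support_poly.
End Truncation.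

(** Sorted types of the pairs whose supports have a union of size j. *)
Definition layer n (j : nat) : seq quad :=
  [seq sort4 t | t <- pair_types n & (t.1.1.2 + t.1.2 + t.2 == j)%N].

Lemma pair_enum_morph (A B : comNzRingType) (h : {rmorphism A -> B}) n (C : code n)
    (x : bool -> bool -> A) :
  h (pair_enum C x) = pair_enum C (fun a b => h (x a b)).
Proof.
rewrite rmorph_sum; apply: eq_bigr => u _; rewrite rmorph_sum; apply: eq_bigr => v _.
exact: rmorph_prod.
Qed.

Section Support.
Variable K : comNzRingType.

Lemma support_gvar a b : support_poly (gvar K a b) = if a || b then 'X else 1.
Proof.
rewrite /support_poly /gvar mmapX mmap1U (inj_eq enum_rank_inj).
have -> : (pairvec a b == 0) = ~~ (a || b); last by case: (a || b).
apply/eqP/idP => [/matrixP e|].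
  by have := e 0 0; have := e 1 0; rewrite !mxE /=; case: a {e}; case: b.
by case: a; case: b => // _; apply/matrixP => i j; rewrite !mxE; case: ifP.
Qed.

Lemma support_weight_enum n (C : code n) j : type2 C -> (8 %| n)%N -> uniq (pair_types n) ->
  (support_poly (weight_enum K 2 C))`_j = (\sum_(l <- layer n j) pair_count C l)%:R.
Proof.
move=> t2 n8 un; rewrite weight_enum_pair_enum pair_enum_morph.
rewrite pair_enum_types // coef_sum natr_sum big_map big_filter [RHS]big_mkcond.
apply: eq_bigr => -[[[a b] c] d] _; rewrite pair_count_sort4 // coefMn /= !support_gvar /=.
rewrite expr1n mul1r -!exprD coefXn eq_sym.
by case: eqP => _; rewrite ?mul0rn.
Qed.

End Support.

(** * A linear relation on the algebra of the codes d_n^+ *)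
Section Relation.
Variable K : numFieldType.

(** The conditions satisfied by the image under [support_poly] of the elements of
degree d of the algebra of the codes d_n^+.  In degrees below 24 the coefficients
of X^4 and X^6 are proportional to d, with the constants found in length 8; in
degree 24 the linear form vanishes both on such proportional triples and on
d_24^+. *)
Definition low_coefs (d : nat) (p : {poly K}) : Prop :=
  [/\ p`_1 = 0, p`_2 = 0, p`_3 = 0, p`_5 = 0 &
   if (d < 24)%N then p`_4 = 21 / 4 * d%:R * p`_0 /\ p`_6 = 21 * d%:R * p`_0
   else 3 * p`_6 - 34 * p`_4 + 2772 * p`_0 = 0].

Lemma low_coefs0 d : low_coefs d 0.
Proof. by split; rewrite ?coef0 //; case: ifP => _; rewrite ?mulr0 ?subr0 ?addr0. Qed.

Lemma low_coefs1 : low_coefs 0 1.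
Proof. by split; rewrite ?coef1 //= !mulr0 mul0r. Qed.

Lemma low_coefs_lin d a p q : low_coefs d p -> low_coefs d q -> low_coefs d (a *: p + q).
Proof.
move=> [p1 p2 p3 p5 pr] [q1 q2 q3 q5 qr]; split; rewrite !coefD !coefZ.
- by rewrite p1 q1 mulr0 addr0.
- by rewrite p2 q2 mulr0 addr0.
- by rewrite p3 q3 mulr0 addr0.
- by rewrite p5 q5 mulr0 addr0.
move: pr qr; case: ifP => _; last first.
  move=> pr qr; transitivity (a * (3 * p`_6 - 34 * p`_4 + 2772 * p`_0) +
    (3 * q`_6 - 34 * q`_4 + 2772 * q`_0)); first ring.
  by rewrite pr qr mulr0 addr0.
by move=> [-> ->] [-> ->]; split; ring.
Qed.

(** The low coefficients multiply like 1 + a X^4 + b X^6, to which a and b add up.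
If both degrees are below 24 and their sum is 24, the form takes the value
(3 * 21 - 34 * 21 / 4) * 24 + 2772 = 0 times the product of the constant terms. *)
Lemma low_coefs_mul i j p q : (i + j <= 24)%N ->
  low_coefs i p -> low_coefs j q -> low_coefs (i + j) (p * q).
Proof.
move=> ij [p1 p2 p3 p5 pr] [q1 q2 q3 q5 qr].
have M0 : (p * q)`_0 = p`_0 * q`_0 + 0.
  by rewrite coefM !big_ord_recl big_ord0.
have M1 : (p * q)`_1 = p`_0 * q`_1 + (p`_1 * q`_0 + 0).
  by rewrite coefM !big_ord_recl big_ord0.
have M2 : (p * q)`_2 = p`_0 * q`_2 + (p`_1 * q`_1 + (p`_2 * q`_0 + 0)).
  by rewrite coefM !big_ord_recl big_ord0.
have M3 : (p * q)`_3 = p`_0 * q`_3 + (p`_1 * q`_2 + (p`_2 * q`_1 + (p`_3 * q`_0 + 0))).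
  by rewrite coefM !big_ord_recl big_ord0.
have M4 : (p * q)`_4 =
    p`_0 * q`_4 + (p`_1 * q`_3 + (p`_2 * q`_2 + (p`_3 * q`_1 + (p`_4 * q`_0 + 0)))).
  by rewrite coefM !big_ord_recl big_ord0.
have M5 : (p * q)`_5 =
    p`_0 * q`_5 + (p`_1 * q`_4 + (p`_2 * q`_3 +
    (p`_3 * q`_2 + (p`_4 * q`_1 + (p`_5 * q`_0 + 0))))).
  by rewrite coefM !big_ord_recl big_ord0.
have M6 : (p * q)`_6 =
    p`_0 * q`_6 + (p`_1 * q`_5 + (p`_2 * q`_4 +
    (p`_3 * q`_3 + (p`_4 * q`_2 + (p`_5 * q`_1 + (p`_6 * q`_0 + 0)))))).
  by rewrite coefM !big_ord_recl big_ord0.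
split; rewrite ?M0 ?M1 ?M2 ?M3 ?M4 ?M5 ?M6 ?p1 ?p2 ?p3 ?p5 ?q1 ?q2 ?q3 ?q5; try ring.
have [i24|i24] := ltnP i 24; last first.
  have [ei ej] : i = 24%N /\ j = 0%N by lia.
  move: pr qr; rewrite ei ej /= !mulr0 !mul0r => pr [-> ->].
  by transitivity ((3 * p`_6 - 34 * p`_4 + 2772 * p`_0) * q`_0); [ring | rewrite pr mul0r].
have [j24|j24] := ltnP j 24; last first.
  have [ei ej] : i = 0%N /\ j = 24%N by lia.
  move: pr qr; rewrite ei ej /= !mulr0 !mul0r => -[-> ->] qr.
  by transitivity (p`_0 * (3 * q`_6 - 34 * q`_4 + 2772 * q`_0)); [ring | rewrite qr mulr0].
move: pr qr; rewrite i24 j24 => -[-> ->] [-> ->]; case: ifP => lt24.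
  by split; rewrite natrD; field.
have -> : i%:R = 24 - j%:R :> K by rewrite -natrB; [congr _%:R; lia | lia].
by field.
Qed.

Lemma low_coefs_weight_enum n (C : code n) (h4 := pair_count C (n - 4, 4, 0, 0)%N)
    (h6 := pair_count C (n - 6, 2, 2, 2)%N) :
  type2 C -> n \in [:: 8; 16; 24]%N ->
  [/\ (support_poly (weight_enum K 2 C))`_0 = 1,
   (support_poly (weight_enum K 2 C))`_4 = (3 * h4)%:R,
   (support_poly (weight_enum K 2 C))`_6 = h6%:R &
   all (fun j => (support_poly (weight_enum K 2 C))`_j == 0) [:: 1; 2; 3; 5]%N].
Proof.
move=> t n_in.
have [[n8 un l0 l4 l6] l1235] :
  [/\ (8 %| n)%N, uniq (pair_types n), layer n 0 = [:: (n, 0, 0, 0)]%N,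
    layer n 4 = nseq 3 (n - 4, 4, 0, 0)%N & layer n 6 = [:: (n - 6, 2, 2, 2)]%N] /\
    all (fun j => nilp (layer n j)) [:: 1; 2; 3; 5]%N.
  by move: n_in; rewrite !inE => /or3P[] /eqP->; vm_compute.
have co := support_weight_enum K _ t n8 un.
rewrite !co l0 l4 l6 !big_cons !big_nil !addn0 pair_count_zero; split=> //.
  by rewrite mulSn mul2n -addnn.
apply/allP => j /(allP l1235)/nilP lj; by rewrite co lj big_nil.
Qed.

Lemma low_coefs_short n (C : code n) : type2 C -> n \in [:: 8; 16]%N ->
  low_coefs n (support_poly (weight_enum K 2 C)).
Proof.
move=> t n_in; have n_in' : n \in [:: 8; 16; 24]%N.
  by move: n_in; rewrite !inE => /orP[]->; rewrite ?orbT.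
have [c0 c4 c6 /and5P[/eqP c1 /eqP c2 /eqP c3 /eqP c5 _]] := low_coefs_weight_enum t n_in'.
split => //; rewrite c0 c4 c6 {c0 c1 c2 c3 c4 c5 c6 n_in'}.
have I n8 un := pair_count_invariant t n8 un.
move: n_in; rewrite !inE => /orP[] /eqP e; subst n => /=.
  have [e4 e6 _] := invariant8 (I isT (uniq_pair_types (n := 8) isT)).
  rewrite pair_count_zero in e4 e6.
  have -> : pair_count C (4, 4, 0, 0)%N = 14%N by lia.
  have -> : pair_count C (2, 2, 2, 2)%N = 168%N by lia.
  by split; field.
have [e4 e6 _] := invariant16 (I isT (uniq_pair_types (n := 16) isT)).
rewrite pair_count_zero in e4 e6.
have -> : pair_count C (12, 4, 0, 0)%N = 28%N by lia.
have -> : pair_count C (10, 2, 2, 2)%N = 336%N by lia.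
by split; field.
Qed.

Lemma low_coefs_d24 : low_coefs 24 (support_poly (weight_enum K 2 (code_of 24 d24_gens))).
Proof.
have [c0 c4 c6 /and5P[/eqP c1 /eqP c2 /eqP c3 /eqP c5 _]] :=
  low_coefs_weight_enum (code_of_type2 d24_even) isT.
split=> //=; rewrite c0 c4 c6 d24_count4 d24_count6; ring.
Qed.

(** The value of the form is (30 - 42) (30 - 66) = 432. *)
Lemma low_coefs_d12 : ~ low_coefs 24 (support_poly (weight_enum K 2 (code_of 24 d12_gens))).
Proof.
have [c0 c4 c6 _] := low_coefs_weight_enum (code_of_type2 d12_even) isT.
move=> [_ _ _ _ /=]; rewrite c0 c4 c6 d12_count4 d12_count6 => /eqP.
have -> : 3 * 240%:R - 34 * (3 * 30)%:R + 2772 * 1 = 432%:R :> K by ring.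
by rewrite pnatr_eq0.
Qed.
End Relation.

(** * Comparison of the three algebras *)
Section Main.
Variable K : numClosedFieldType.
Notation W := (weight_enum K 2).
Notation ringA := (ringA K 2).
Notation ringB := (ringB K 2).
Notation ringD := (ringD K 2).

Lemma length_cases n : (0 < n <= 24)%N -> (8 %| n)%N -> [\/ n = 8%N, n = 16%N | n = 24%N].
Proof.
move=> n24 /dvdnP[[|[|[|[|k]]]] e]; try lia.
- by constructor 1.
- by constructor 2.
- by constructor 3.
Qed.

Lemma dplus_type2 n : (0 < n <= 24)%N -> (8 %| n)%N -> type2 (dplus n).
Proof.
move=> n24 /(length_cases n24) e; rewrite dplus_code_of; apply: code_of_type2.
by case: e => ->; [exact: d8_even | exact: d16_even | exact: d24_even].
Qed.

Lemma ringA_closed :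
  [/\ ringA 1, forall a p q, ringA p -> ringA q -> ringA (a *: p + q) &
      forall p q, ringA p -> ringA q -> ringA (p * q)].
Proof. exact: subalg_gen_closed. Qed.

Lemma ringB_closed :
  [/\ ringB 1, forall a p q, ringB p -> ringB q -> ringB (a *: p + q) &
      forall p q, ringB p -> ringB q -> ringB (p * q)].
Proof. exact: subalg_gen_closed. Qed.

Lemma ringD_in_ringA p : ringD p -> ringA p.
Proof.
apply: subalg_gen_min => [|_ [n [n0 n8 ->]]].
  exact/subalg_closedP/ringA_closed.
by apply: subalg_gen_incl; exists n, (dplus n); split=> //; left.
Qed.

Lemma dplus_ringA n : (0 < n)%N -> (8 %| n)%N -> ringA (W (dplus n)).
Proof. by move=> n0 n8; apply: subalg_gen_incl; exists n, (dplus n); split => //; left. Qed.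

Lemma neighbor_ringA n (C : code n) : (0 < n)%N -> (8 %| n)%N ->
  type2 C -> neighbors C (dplus n) -> ringA (W C).
Proof.
by move=> n0 n8 t nb; apply: subalg_gen_incl; exists n, C; split => //; right.
Qed.

Lemma weight_enum_length0 (C : code 0) : self_dual C -> W C = 1.
Proof.
move=> /self_dual_card; rewrite expnS expn1 expn0 => c1.
rewrite weight_enum_pair_enum /pair_enum.
under eq_bigr => u _ do under eq_bigr => v _ do rewrite big_ord0.
by rewrite !sumr_const -mulrnA c1.
Qed.

(** In lengths 8 and 16 the weight enumerator is that of d_n^+; in length 24 it is a
combination of those of d_24^+ and of two of its neighbors. *)
Lemma type2_ringA n (C : code n) : type2 C -> (n <= 24)%N -> ringA (W C).
Proof.
move=> t n24; have n8 := type2_dvd8 K t.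
have [k e] := dvdnP n8; case: k e => [|[|[|[|k]]]] e; last lia.
- have {}e : n = 0%N by rewrite e.
  by subst n; rewrite (weight_enum_length0 t.1); case: ringA_closed.
- have {}e : n = 8%N by rewrite e.
  subst n; suff -> : W C = W (dplus 8) by apply: dplus_ringA.
  rewrite !weight_enum_pair_enum.
  apply: (pair_enum_unique _ _ n8 (uniq_pair_types (n := 8) isT) t).
    by move=> f /invariant8[_ _ det]; exact: det.
  exact: dplus_type2.
- have {}e : n = 16%N by rewrite e.
  subst n; suff -> : W C = W (dplus 16) by apply: dplus_ringA.
  rewrite !weight_enum_pair_enum.
  apply: (pair_enum_unique _ _ n8 (uniq_pair_types (n := 16) isT) t).
    by move=> f /invariant16[_ _ det]; exact: det.
  exact: dplus_type2.
have {}e : n = 24%N by rewrite e.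
subst n.
have := pair_enum_relation (gvar K) t (code_of_type2 d24_even) (code_of_type2 e8d16_even)
  (code_of_type2 d12_even) n8 (uniq_pair_types (n := 24) isT)
  (pair_count24_interpolation t erefl erefl).
have scaleZ z (p : genus_poly K 2) : ofZ _ z * p = (int_of_Z z)%:~R *: p.
  by rewrite /ofZ mulrzl scaler_int.
rewrite -!weight_enum_pair_enum !scaleZ.
have nz : (int_of_Z 864)%:~R != 0 :> K by rewrite intr_eq0.
move=> /(canRL (scalerK nz)) ->.
have [A1 lin _] := ringA_closed.
have A0 : ringA 0 by exact: subalg_gen0.
have scal a p : ringA p -> ringA (a *: p) by move=> Ap; rewrite -[_ *: _]addr0; exact: lin.
have Ad p q : ringA p -> ringA q -> ringA (p + q) by rewrite -{2}[p]scale1r; exact: lin.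
apply: (scal); apply: (Ad); first apply: (Ad); apply: (scal).
- by rewrite -dplus_code_of; exact: dplus_ringA.
- by apply: neighbor_ringA e8d16_neighbor => //; exact: code_of_type2 e8d16_even.
- by apply: neighbor_ringA d12_neighbor => //; exact: code_of_type2 d12_even.
Qed.

Lemma dplus_ringB n : (0 < n <= 24)%N -> (8 %| n)%N -> ringB (W (dplus n)).
Proof.
move=> n24 n8; apply: subalg_gen_incl; exists n, (dplus n).
by split=> //; exact: dplus_type2.
Qed.

Lemma low_coefs_dplus n : (0 < n <= 24)%N -> (8 %| n)%N ->
  low_coefs n (support_poly (W (dplus n))).
Proof.
move=> n24 n8; have t := dplus_type2 n24 n8.
have [e|e|e] := length_cases n24 n8.
- by apply: low_coefs_short => //; rewrite e.
- by apply: low_coefs_short => //; rewrite e.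
by rewrite e dplus_code_of; exact: low_coefs_d24.
Qed.

Lemma ringB_in_ringA d p : (d <= 24)%N -> ringB p -> p \is d.-homog -> ringA p.
Proof.
move=> d24 Bp hp; have [A1 lin Am] := ringA_closed; rewrite -(pihomog_dE hp).
apply: (@subalg_gen_graded _ _ _ 24 (fun=> ringA) _ _ _ _ _ _ Bp) => //.
- by move=> _; exact: subalg_gen0.
- by move=> i j q r _; exact: Am.
by move=> _ [n [C [t ->]]]; exists n; [exact: weight_enum_homog | exact: type2_ringA].
Qed.

Lemma ringA_in_ringB d p : (d <= 24)%N -> ringA p -> p \is d.-homog -> ringB p.
Proof.
move=> d24 Ap hp; have [B1 lin Bm] := ringB_closed; rewrite -(pihomog_dE hp).
apply: (@subalg_gen_graded _ _ _ 24 (fun=> ringB) _ _ _ _ _ _ Ap) => //.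
- by move=> _; exact: subalg_gen0.
- by move=> i j q r _; exact: Bm.
move=> _ [n [C [n0 n8 C_nb ->]]]; exists n; first exact: weight_enum_homog.
move=> n24; case: C_nb => [->|[t _]]; first by apply: dplus_ringB; rewrite ?n0.
by apply: subalg_gen_incl; exists n, C.
Qed.

Lemma ringD_low_coefs d p : (d <= 24)%N -> ringD p -> p \is d.-homog ->
  low_coefs d (support_poly p).
Proof.
move=> d24 Dp hp; rewrite -(pihomog_dE hp).
apply: (@subalg_gen_graded _ _ _ 24 (fun e q => low_coefs e (support_poly q))
  _ _ _ _ _ _ Dp) => //.
- by move=> e; rewrite raddf0; exact: low_coefs0.
- move=> e a q r; rewrite rmorphD /= -[a *: q]mul_mpolyC rmorphM /=.
  rewrite /support_poly mmapC mul_polyC; exact: low_coefs_lin.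
- by rewrite rmorph1; exact: low_coefs1.
- by move=> i j q r ij qi rj; rewrite rmorphM; exact: low_coefs_mul.
move=> _ [n [n0 n8 ->]]; exists n; first exact: weight_enum_homog.
by move=> n24; apply: low_coefs_dplus; rewrite ?n0.
Qed.
End Main.

Local Close Scope ring_scope.

(* [R[i]] is the field of complex numbers. *)
Theorem theorem7p2 (R : realType) :
  up_to_degree 24 (ringD R[i] 2) `<` up_to_degree 24 (ringA R[i] 2) /\
  up_to_degree 24 (ringA R[i] 2) = up_to_degree 24 (ringB R[i] 2).
Proof.
split; last first.
  by apply/seteqP; split; apply: up_to_degreeP => d p d24;
    [exact: ringA_in_ringB | exact: ringB_in_ringA].
split; first by apply: up_to_degreeP => d p _ Dp _; exact: ringD_in_ringA.
have d12A : ringA R[i] 2 (weight_enum R[i] 2 (code_of 24 d12_gens)).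
  by apply: neighbor_ringA d12_neighbor => //; exact: code_of_type2 d12_even.
have homW := weight_enum_homog R[i] (code_of 24 d12_gens).
move=> AD; apply: (@low_coefs_d12 R[i]).
have iff24 S := @up_to_degree_homog R[i] 2 24 24 S _ isT homW.
by apply: ringD_low_coefs => //; apply/iff24/AD/iff24.
Qed.
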